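(* Let $U$ be an open subset of a complex Banach space $E$ and let $v$ be a weight on $U$. Suppose that $H^\infty_v(U)$ has the $WH^\infty$-BPB property and let $F$ be a complex Banach space satisfying the property $\beta$. Then $H^\infty_v(U,F)$ has the $WH^\infty$-BPB property.
   Context: Notation: $B_X$, $S_X$ are the closed unit ball and unit sphere of a Banach space $X$; $\mathbb{T}$ is the unit circle of $\mathbb{C}$. A weight on $U$ is a strictly positive continuous function on $U$. $H^\infty_v(U,F)$ is the Banach space of holomorphic mappings $f:U\to F$ with $\|f\|_v:=\sup\{v(z)\|f(z)\|: z\in U\}<\infty$; $H^\infty_v(U):=H^\infty_v(U,\mathbb{C})$. $G^\infty_v(U)$ is the space of all linear functionals on $H^\infty_v(U)$ whose restriction to $B_{H^\infty_v(U)}$ is continuous for the compact-open topology; it is a closed subspace of $H^\infty_v(U)^*$, with the norm of $H^\infty_v(U)^*$. For $z\in U$, $\delta_z\in G^\infty_v(U)$ is the evaluation $\delta_z(f)=f(z)$. $WH^\infty$-BPB property: $H^\infty_v(U,F)$ has the $WH^\infty$-BPB property if for every $0<\varepsilon<1$ there is $0<\eta(\varepsilon)<\varepsilon$ such that for every $f\in S_{H^\infty_v(U,F)}$, every $\lambda\in\mathbb{T}$ and every $z\in U$ with $v(z)\|f(z)\|>1-\eta(\varepsilon)$, there exist $f_0\in S_{H^\infty_v(U,F)}$, $\lambda_0\in\mathbb{T}$ and $z_0\in U$ such that $v(z_0)\|f_0(z_0)\|=1$, $\|f-f_0\|_v<\varepsilon$ and $\|\lambda v(z)\delta_z-\lambda_0v(z_0)\delta_{z_0}\|<\varepsilon$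 (the last norm being that of $G^\infty_v(U)$). For $H^\infty_v(U)$ this is the case $F=\mathbb{C}$. Property $\beta$: a Banach space $F$ has the property $\beta$ if there are a set $\{(y_i,y_i^* ): i\in I\}\subseteq F\times F^*$ and a constant $0\le\rho<1$ such that (i) $\|y_i^*\|=\|y_i\|=y_i^*(y_i)=1$ for every $i\in I$; (ii) $|y_i^*(y_j)|\le\rho$ for all $i,j\in I$ with $i\ne j$; (iii) $\|y\|=\sup\{|y_i^*(y)|: i\in I\}$ for every $y\in F$. *)

(* Defs.v *)
From HB Require Import structures.
From mathcomp Require Import all_boot all_order all_algebra.
From mathcomp Require Import all_classical all_reals all_analysis.
From mathcomp Require Import complex.

Set Implicit Arguments.
Unset Strict Implicit.
Unset Printing Implicit Defensive.

Import Order.TTheory GRing.Theory Num.Theory.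
Import numFieldNormedType.Exports.

Local Open Scope classical_set_scope.
Local Open Scope ring_scope.
Local Open Scope complex_scope.

(* A complex Banach space is a [completeNormedModType R[i]], with R the reals;
   the scalar field as a normed space over itself is [R[i]^o].
   A map U -> F on an open set U of E is represented by a total map E -> F;
   all the notions below depend only on its values on U. *)

(* The norm of a normed module over R[i] takes its values in R[i] (they are
   nonnegative reals there); this is the same number, in R. *)
Definition rnorm (R : realType) (V : normedModType R[i]) (x : V) : R :=
  complex.Re `|x|.

Definition weight (R : realType) (E : normedModType R[i]) (U : set E)
    (v : E -> R) : Prop :=
  {within U, continuous v} /\ forall z, U z -> 0 < v z.

(* [differentiable] is Frechet differentiability over R[i], i.e. with a
   continuous complex-linear differential. *)
Definition holomorphic (R : realType) (E F : normedModType R[i]) (U : set E)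
    (f : E -> F) : Prop :=
  forall z, U z -> differentiable f z.

Section WeightedSpace.
Variables (R : realType) (E F : normedModType R[i]) (U : set E) (v : E -> R).

Definition weighted_values (f : E -> F) : set R :=
  [set v z * rnorm (f z) | z in U].

(* For U empty this is [sup set0], which is 0. *)
Definition vnorm (f : E -> F) : R := sup (weighted_values f).

Definition Hv : set (E -> F) :=
  [set f | holomorphic U f /\ has_ubound (weighted_values f)].

Definition Hv_ball : set (E -> F) := [set f | Hv f /\ vnorm f <= 1].

Definition Hv_sphere : set (E -> F) := [set f | Hv f /\ vnorm f = 1].

End WeightedSpace.

Definition delta (R : realType) (E : normedModType R[i]) (z : E) :
    (E -> R[i]^o) -> R[i]^o :=
  fun g => g z.

(* The norm of the dual of H^infty_v(U), which is also that of its subspace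
   G^infty_v(U). *)
Definition Gv_norm (R : realType) (E : normedModType R[i]) (U : set E)
    (v : E -> R) (phi : (E -> R[i]^o) -> R[i]^o) : R :=
  sup [set rnorm (phi g) | g in @Hv_ball R E R[i]^o U v].

Definition WH_BPB (R : realType) (E F : normedModType R[i]) (U : set E)
    (v : E -> R) : Prop :=
  forall eps : R, 0 < eps < 1 ->
  exists eta : R, 0 < eta < eps /\
  forall (f : E -> F) (lam : R[i]) (z : E),
    Hv_sphere U v f -> `|lam| = 1 -> U z -> v z * rnorm (f z) > 1 - eta ->
  exists (f0 : E -> F) (lam0 : R[i]) (z0 : E),
    [/\ Hv_sphere U v f0, `|lam0| = 1 & U z0] /\
    [/\ v z0 * rnorm (f0 z0) = 1,
        vnorm U v (f - f0) < eps &
        Gv_norm U v ((lam * (v z)%:C) *: delta z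
                     - (lam0 * (v z0)%:C) *: delta z0) < eps].

Definition dual_norm (R : realType) (F : normedModType R[i])
    (phi : {linear F -> R[i]^o}) : R :=
  sup [set rnorm (phi y) | y in [set y : F | rnorm y <= 1]].

Definition property_beta (R : realType) (F : normedModType R[i]) : Prop :=
  exists (I : Type) (y : I -> F) (ystar : I -> {linear F -> R[i]^o}) (rho : R),
    [/\ forall i, continuous (ystar i : F -> R[i]^o), 0 <= rho < 1,
        forall i, [/\ dual_norm (ystar i) = 1, rnorm (y i) = 1 &
                      ystar i (y i) = 1],
        forall i j, i <> j -> rnorm (ystar i (y j)) <= rho &
        forall x : F, rnorm x = sup [set rnorm (ystar i x) | i in [set: I]]].

(* Main.v *)
Require Import Defs.
From HB Require Import structures.
From mathcomp Require Import all_boot all_order all_algebra.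
From mathcomp Require Import all_classical all_reals all_analysis.
From mathcomp Require Import complex.
From mathcomp Require Import lra.

(* With (y_i, y_i^* ) as in the property beta, choose i such that y_i^* nearly
   norms f(z), approximate the normalized scalar map y_i^* o f by some g0
   attaining its norm at z0, and change f only along y_i: up to normalization,
   f0 = f + ((1 + r) g0 - y_i^* o f) y_i, so that y_i^* o f0 = (1 + r) g0.
   The gap rho < 1 leaves room for choosing r small, yet large enough that the
   other functionals y_j^* see a norm at most 1 + r; since the y_j^* are
   norming, f0 attains its norm at z0. *)

Set Implicit Arguments.
Unset Strict Implicit.
Unset Printing Implicit Defensive.

Import Order.TTheory GRing.Theory Num.Theory.
Import numFieldNormedType.Exports.

Local Open Scope classical_set_scope.
Local Open Scope ring_scope.
Local Open Scope complex_scope.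

(** * The norm as a real number *)

Section RealNorm.
Variables (R : realType) (V : normedModType R[i]).
Implicit Types (x y : V) (c : R[i]).

Lemma rnormE x : `|x| = (rnorm x)%:C.
Proof. by rewrite /rnorm RRe_real// normr_real. Qed.

Lemma rnorm_ge0 x : 0 <= rnorm x.
Proof. by rewrite -lecR -rnormE normr_ge0. Qed.

Lemma rnormD x y : rnorm (x + y) <= rnorm x + rnorm y.
Proof. by rewrite -lecR rmorphD/= -!rnormE ler_normD. Qed.

Lemma rnormZ c x : rnorm (c *: x) = rnorm (c : R[i]^o) * rnorm x.
Proof. by apply: complexI; rewrite rmorphM/= -!rnormE normrZ. Qed.

Lemma rnormN x : rnorm (- x) = rnorm x.
Proof. by rewrite /rnorm normrN. Qed.

Lemma rnorm0_eq0 x : rnorm x = 0 -> x = 0.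
Proof. by move=> x0; apply/eqP; rewrite -normr_eq0 rnormE x0. Qed.

Lemma rnorm0 : rnorm (0 : V) = 0.
Proof. by rewrite /rnorm normr0. Qed.

End RealNorm.

Lemma rnorm_real (R : realType) (a : R) :
  0 <= a -> rnorm (a%:C : R[i]^o) = a.
Proof. by move=> a0; apply: complexI; rewrite -rnormE ger0_norm ?lecR. Qed.

(** * The weighted supremum norm *)

Section WeightedNorm.
Variables (R : realType) (E F : normedModType R[i]) (U : set E) (v : E -> R).
Implicit Types (f : E -> F) (z : E).

Lemma vnorm_ge f z :
  Hv U v f -> U z -> v z * rnorm (f z) <= vnorm U v f.
Proof. by move=> [_ ub] Uz; apply: ub_le_sup => //; exists z. Qed.

Lemma vnorm_le f z (c : R) : U z ->
  (forall w, U w -> v w * rnorm (f w) <= c) -> vnorm U v f <= c.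
Proof.
move=> Uz fc; apply: ge_sup => [|_ [w Uw <-]]; last exact: fc.
by exists (v z * rnorm (f z)), z.
Qed.

Lemma Hv_sphere_attained f z : holomorphic U f -> U z ->
  (forall w, U w -> v w * rnorm (f w) <= 1) -> v z * rnorm (f z) = 1 ->
  Hv_sphere U v f.
Proof.
move=> hf Uz f1 fz; have Hf : Hv U v f.
  by split=> //; exists 1 => _ [w Uw <-]; exact: f1.
split=> //; apply/eqP; rewrite eq_le (vnorm_le Uz)//=.
by rewrite -fz vnorm_ge.
Qed.

End WeightedNorm.

(** * Norming families of functionals *)

Section NormingFamily.
Variables (R : realType) (F : normedModType R[i]) (I : Type).
Variable ystar : I -> {linear F -> R[i]^o}.
Hypothesis norming :
  forall x : F, rnorm x = sup [set rnorm (ystar i x) | i in [set: I]].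

(* Were the set of the |y_i^*(x)| unbounded, its [sup] would be the junk
   value 0, forcing x = 0, for which the set is bounded. *)
Lemma norming_le i x : rnorm (ystar i x) <= rnorm x.
Proof.
set A := [set rnorm (ystar i x) | i in [set: I]].
have [hA|nA] := pselect (has_ubound A).
  by rewrite (norming x); apply: ub_le_sup => //; exists i.
have /rnorm0_eq0 -> : rnorm x = 0.
  by rewrite norming sup_out// => -[].
by rewrite linear0 !rnorm0.
Qed.

Lemma norming_gt (x : F) (c : R) : 0 <= c -> c < rnorm x ->
  exists i, c < rnorm (ystar i x).
Proof.
move=> c0; rewrite norming; set A := [set _ | _ in _] => cA.
(* For an empty index set the [sup] is the default 0, which [0 <= c] rules out. *)
have [A0|/set0P nA] := eqVneq A set0.
  by move: cA; rewrite A0 sup0 ltNge c0.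
by have [_ [i _ <-] ?] := sup_gt nA cA; exists i.
Qed.

Lemma norming_ub (x : F) (c : R) : 0 <= c ->
  (forall i, rnorm (ystar i x) <= c) -> rnorm x <= c.
Proof.
move=> c0 xc; rewrite leNgt; apply/negP => cx.
by have [j] := norming_gt c0 cx; rewrite ltNge xc.
Qed.

End NormingFamily.

(** * Stability of holomorphy *)

Section Holomorphic.
Variables (R : realType) (E F : normedModType R[i]) (U : set E).

Lemma holomorphic_linear_comp (G : normedModType R[i])
    (l : {linear F -> G}) (f : E -> F) :
  continuous l -> holomorphic U f -> holomorphic U (l \o f).
Proof.
move=> cl hf z Uz; apply: differentiable_comp; first exact: hf.
exact: linear_differentiable.
Qed.

Lemma holomorphicD (f g : E -> F) :
  holomorphic U f -> holomorphic U g -> holomorphic U (f + g).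
Proof. by move=> hf hg z Uz; apply: differentiableD; [exact: hf|exact: hg]. Qed.

Lemma holomorphicZ (c : R[i]) (f : E -> F) :
  holomorphic U f -> holomorphic U (c *: f).
Proof. by move=> hf z Uz; apply: differentiableZ; exact: hf. Qed.

Lemma holomorphic_scale (g : E -> R[i]^o) (y : F) :
  holomorphic U g -> holomorphic U (fun z => g z *: y).
Proof.
by move=> hg z Uz; apply: differentiableZl; exact: hg.
Qed.

End Holomorphic.

(** * Pointwise estimates for the change along [y i] *)

Section Perturbation.
Variables (R : realType) (F : normedModType R[i]) (I : Type).
Variables (y : I -> F) (ystar : I -> {linear F -> R[i]^o}) (rho : R).
Hypotheses (y1 : forall i, rnorm (y i) = 1)
  (ystary : forall i, ystar i (y i) = 1)
  (ystar_sep : forall i j, i <> j -> rnorm (ystar i (y j)) <= rho)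
  (norming :
    forall x : F, rnorm x = sup [set rnorm (ystar i x) | i in [set: I]]).

(** The value of f0 at one point, already normalized: [x] stands for f(z) and [t] for g0(z). *)
Definition perturb (r : R) (i : I) (t : R[i]^o) (x : F) : F :=
  ((1 + r)^-1)%:C *: (x + ((1 + r)%:C *: t - ystar i x) *: y i).

Variables (r d w : R) (i : I) (t : R[i]^o) (x : F).
Hypotheses (r0 : 0 <= r) (w0 : 0 < w) (x1 : w * rnorm x <= 1)
  (t1 : w * rnorm t <= 1) (tx : w * rnorm (t - ystar i x) <= d).

Lemma ystar_perturb : ystar i (perturb r i t x) = t.
Proof.
rewrite linearZ/= linearD/= linearZ/= ystary.
rewrite [_ *: (1 : R[i]^o)]mulr1 subrKC scalerA -rmorphM/=.
by rewrite mulVf ?scale1r// gt_eqF// ltr_pwDl.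
Qed.

(** The coefficient of [y i] splits as r t + (t - y_i^*(x)), whose terms weigh at most r and d. *)
Lemma correction_le :
  w * rnorm ((1 + r)%:C *: t - ystar i x : R[i]^o) <= r + d.
Proof.
have -> : (1 + r)%:C *: t - ystar i x = r%:C *: t + (t - ystar i x).
  by rewrite rmorphD rmorph1 scalerDl scale1r -addrA addrCA.
apply: le_trans (ler_wpM2l (ltW w0) (rnormD _ _)) _.
rewrite mulrDr rnormZ rnorm_real// mulrCA lerD//.
by rewrite ler_piMr.
Qed.

(** It suffices to test each y_j^*. For j = i the value is t. For j <> i, before normalization, x
    contributes at most 1 and the correction at most rho (r + d) <= r; the factor 1 / (1 + r)
    absorbs the total 1 + r. *)
Lemma perturb_le1 : rho * (r + d) <= r ->
  w * rnorm (perturb r i t x) <= 1.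
Proof.
move=> rd; have s0 : 0 < 1 + r by rewrite ltr_pwDl.
rewrite mulrC -ler_pdivlMr//; apply: (norming_ub norming) => [|j].
  by rewrite divr_ge0// ltW.
rewrite ler_pdivlMr// mulrC; have [<-|ij] := pselect (i = j).
  by rewrite ystar_perturb.
rewrite linearZ/= linearD/= linearZ/= rnormZ rnorm_real ?invr_ge0 ?(ltW s0)//.
rewrite mulrCA mulrC ler_pdivrMr// mul1r.
apply: le_trans (ler_wpM2l (ltW w0) (rnormD _ _)) _.
rewrite mulrDr lerD//.
  by apply: le_trans x1; rewrite ler_pM2l// (norming_le norming).
rewrite rnormZ mulrA; apply: le_trans rd; rewrite mulrC.
apply: ler_pM; rewrite ?rnorm_ge0 ?mulr_ge0 ?rnorm_ge0 ?(ltW w0) ?correction_le//.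
by apply: ystar_sep => ji; apply: ij.
Qed.

(** The difference is (r x - correction) / (1 + r): normalizing costs r, the correction r + d, and
    dividing by 1 + r >= 1 does no harm. *)
Lemma perturb_dist : w * rnorm (x - perturb r i t x) <= 2 * r + d.
Proof.
have s0 : 0 < 1 + r by rewrite ltr_pwDl.
have -> : x - perturb r i t x = ((1 + r)^-1)%:C *:
    (r%:C *: x - ((1 + r)%:C *: t - ystar i x) *: y i).
  rewrite [in RHS](_ : r%:C *: x = (1 + r)%:C *: x - x); last first.
    by rewrite rmorphD rmorph1 scalerDl scale1r addrC addKr.
  rewrite -addrA -opprD scalerBr scalerA -rmorphM/= mulVf ?gt_eqF//.
  by rewrite scale1r.
rewrite rnormZ rnorm_real ?invr_ge0 ?(ltW s0)// mulrCA mulrC ler_pdivrMr//.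
have : w * rnorm (r%:C *: x - ((1 + r)%:C *: t - ystar i x) *: y i) <=
    2 * r + d.
  apply: le_trans (ler_wpM2l (ltW w0) (rnormD _ _)) _.
  rewrite -scaleNr !rnormZ y1 mulr1 rnorm_real// mulrDr.
  have -> : 2 * r + d = r + (r + d) by lra.
  by rewrite lerD ?rnormN ?correction_le// mulrCA ler_piMr.
move=> /le_trans; apply; rewrite ler_peMr ?lerDl//.
rewrite addr_ge0 ?mulr_ge0//; apply: le_trans tx.
by rewrite mulr_ge0 ?rnorm_ge0// ltW.
Qed.

End Perturbation.

Lemma holomorphic_perturb (R : realType) (E F : normedModType R[i])
    (U : set E) (I : Type) (y : I -> F) (ystar : I -> {linear F -> R[i]^o})
    (r : R) (i : I) (g : E -> R[i]^o) (f : E -> F) :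
  continuous (ystar i) -> holomorphic U g -> holomorphic U f ->
  holomorphic U (fun z => perturb y ystar r i (g z) (f z)).
Proof.
move=> cy hg hf; apply: holomorphicZ; apply: holomorphicD => //.
apply: holomorphic_scale.
have := holomorphic_linear_comp cy hf.
move=> /(holomorphicZ (-1)) /(holomorphicD (holomorphicZ (1 + r)%:C hg)).
by rewrite scaleN1r.
Qed.

(** * Transfer of the property from scalar to vector values *)

Theorem theorem2p9 (R : realType) (E : completeNormedModType R[i])
    (U : set E) (v : E -> R) (F : completeNormedModType R[i]) :
  open U -> weight U v ->
  @WH_BPB R E R[i]^o U v ->
  property_beta F ->
  @WH_BPB R E F U v.
Proof.
move=> _ [_ v0] bpb [I [y [ystar [rho [cy /andP[rho0 rho1] yP sep norming]]]]].
move=> eps /andP[eps0 eps1].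
(* With d = 2 e', these give r + d = eps / 4, so that rho (r + d) = r exactly, and 2 r + d = eps (1
   + rho) / 4 < eps. *)
pose e' := eps * (1 - rho) / 8; pose r := rho * eps / 4.
have r0 : 0 <= r by rewrite /r divr_ge0// mulr_ge0// ltW.
have e'0 : 0 < e' by rewrite /e' divr_gt0// mulr_gt0// subr_gt0.
have e'eps : e' < eps by rewrite /e'; nra.
have [|eta [/andP[eta0 etae'] {}bpb]] := bpb e'.
  by rewrite e'0 (lt_trans e'eps).
exists eta; rewrite eta0 (lt_trans etae')//; split=> // f lam z.
move=> [Hf f1] lam1 Uz fz.
have eta1 : eta < 1 by lra.
have fle w : U w -> v w * rnorm (f w) <= 1 by rewrite -f1; exact: vnorm_ge.
have [i yfz] : exists i, (1 - eta) / v z < rnorm (ystar i (f z)).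
  apply: (norming_gt norming).
    by rewrite divr_ge0 ?subr_ge0 ?ltW ?v0.
  by rewrite ltr_pdivrMr ?v0// mulrC.
rewrite ltr_pdivrMr ?v0// mulrC in yfz.
have yfle w : U w -> v w * rnorm (ystar i (f w)) <= 1.
  move=> Uw; apply: le_trans (fle _ Uw).
  by rewrite ler_pM2l ?v0// (norming_le norming).
have Hyf : Hv U v (ystar i \o f).
  split; first by apply: holomorphic_linear_comp (cy i) Hf.1.
  by exists 1 => _ [w Uw <-]; exact: yfle.
pose a := vnorm U v (ystar i \o f).
have a_gt : 1 - eta < a by apply: lt_le_trans yfz (vnorm_ge Hyf Uz).
have a_le1 : a <= 1 by exact: (vnorm_le Uz).
have a0 : 0 < a by lra.
(* The scalar property applies only on the unit sphere, hence the division by the norm a. As a <= 1,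
   the value at z does not decrease and stays above 1 - eta. *)
pose g : E -> R[i]^o := (a^-1)%:C *: (ystar i \o f).
have gE w : rnorm (ystar i (f w)) = a * rnorm (g w).
  by rewrite rnormZ rnorm_real ?invr_ge0 ?(ltW a0)// mulVKf// gt_eqF.
have gle w : U w -> v w * rnorm (g w) <= 1.
  move=> Uw; rewrite -(ler_pM2l a0) mulr1 mulrCA -gE.
  exact: (vnorm_ge Hyf Uw).
have Sg : Hv_sphere U v g.
  have Hg : Hv U v g.
    split; first by apply: holomorphicZ; exact: Hyf.1.
    by exists 1 => _ [w Uw <-]; exact: gle.
  split=> //; apply/eqP; rewrite eq_le (vnorm_le Uz)//=.
  rewrite -(ler_pM2l a0) mulr1 {1}/a.
  apply: (vnorm_le Uz) => // w Uw /=.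
  by rewrite gE mulrCA ler_pM2l// vnorm_ge.
have [] := bpb g lam z Sg lam1 Uz.
  apply: (lt_le_trans yfz); rewrite gE mulrCA ler_piMl//.
  by rewrite mulr_ge0 ?rnorm_ge0// ltW ?v0.
move=> g0 [lam0 [z0 [[[Hg0 g01] lam01 Uz0] [g0z0 gg0 deltas]]]].
have g0le w : U w -> v w * rnorm (g0 w) <= 1.
  by rewrite -g01; exact: vnorm_ge.
(* Boundedness makes [vnorm] of g - g0 a genuine supremum, so that it controls the pointwise
   values. *)
have Hgg0 : Hv U v (g - g0).
  split.
    rewrite -scaleN1r; apply: holomorphicD; first exact: Sg.1.1.
    by apply: holomorphicZ; exact: Hg0.1.
  exists 2 => _ [w Uw <-].
  apply: le_trans (ler_wpM2l (ltW (v0 _ Uw)) (rnormD _ _)) _.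
  rewrite mulrDr (_ : 2 = 1 + 1)// lerD ?gle// rnormN.
  exact: g0le.
have g0yf w : U w -> v w * rnorm (g0 w - ystar i (f w)) <= 2 * e'.
  move=> Uw.
  (* Since a g = y_i^* o f, the error has two parts: g - g0, of norm below e', and (1 - a) g, of
     norm at most 1 - a < eta < e'. *)
  have -> : g0 w - ystar i (f w) = - (g - g0) w + (1 - a)%:C *: g w.
    rewrite [(g - g0) w]/= rmorphB/= scalerBl scale1r.
    rewrite [a%:C *: g w]scalerA -rmorphM/= divff ?gt_eqF// scale1r.
    by rewrite opprB addrA subrK.
  apply: le_trans (ler_wpM2l (ltW (v0 _ Uw)) (rnormD _ _)) _.
  rewrite mulrDr rnormZ rnorm_real ?subr_ge0// rnormN.
  have := vnorm_ge Hgg0 Uw; have := gle _ Uw.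
  rewrite mulrCA => gw ggw.
  have : (1 - a) * (v w * rnorm (g w)) <= 1 - a by rewrite ler_piMr ?subr_ge0.
  lra.
have y1 j : rnorm (y j) = 1 by have [] := yP j.
have ystary j : ystar j (y j) = 1 by have [] := yP j.
pose f0 w := perturb y ystar r i (g0 w) (f w).
have f0le w : U w -> v w * rnorm (f0 w) <= 1.
  move=> Uw; rewrite /f0.
  apply: (perturb_le1 ystary sep norming r0 (v0 _ Uw)
    (fle _ Uw) (g0le _ Uw) (g0yf _ Uw)).
  by rewrite /r /e'; lra.
have f0z0 : v z0 * rnorm (f0 z0) = 1.
  apply/eqP; rewrite eq_le f0le//= -g0z0 ler_pM2l ?v0//.
  (* y_i^* sends f0(z0) to g0(z0), so the norm of f0(z0) is at least that of g0(z0). *)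
  rewrite -{1}(ystar_perturb ystary i (g0 z0) (f z0) r0).
  exact: (norming_le norming).
exists f0, lam0, z0; do 2!split=> //.
- apply: (Hv_sphere_attained (z := z0)) => //.
  by apply: holomorphic_perturb; [exact: cy|exact: Hg0.1|exact: Hf.1].
(* A uniform bound strictly below eps is needed, as the supremum preserves only weak
   inequalities. *)
- apply: (@le_lt_trans _ _ (2 * r + 2 * e')); last by rewrite /r /e'; nra.
  apply: (vnorm_le Uz) => // w Uw.
  exact: (perturb_dist y1 r0 (v0 _ Uw) (fle _ Uw) (g0le _ Uw) (g0yf _ Uw)).
- exact: lt_trans deltas e'eps.
Qed.
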